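(* Let $(X,d)$ be a $\delta$-hyperbolic graph with a basepoint $o$. There exists a constant $a_0>0$ such that for any $a\in(0,a_0]$ there exists a constant $C\ge1$ for which $$C^{-1}\rho_{\lambda,o}(\xi,\eta)\le\nu_{a,o}(\xi,\eta)\le C\rho_{\lambda,o}(\xi,\eta)\qquad\text{for all }\xi,\eta\in\partial X,$$ where $\lambda=e^{-a}$, $\nu_{a,o}$ is the visual metric and $\rho_{\lambda,o}$ the Floyd metric on $\partial X$.
   Context: $X$ is a connected graph with edges of length $1$, Gromov $\delta$-hyperbolic for its path metric $d$, and $\partial X$ is its Gromov boundary. Visual metric. For $a>0$ put $\delta_{a,o}(\xi,\eta)=e^{-a(\xi|\eta)}$, where $(\xi|\eta)$ is the Gromov product on $\partial X$ with basepoint $o$, and $$\nu_{a,o}(\xi,\eta)=\inf\Big\{\sum_{i=1}^n\delta_{a,o}(c_{i-1},c_i)\Big\},$$ the infimum over all $n\ge1$ and all finite chains $c_0=\xi,c_1,\dots,c_n=\eta$ of points of $\partial X$. If $a<\frac{\ln2}{6\delta}$ then $\nu_{a,o}$ is a metric on $\partial X$. Floyd metric. For $\lambda\in(0,1)$ assign to each edge $e$ of $X$ the length $\lambda^{d(o,e)}$; $\rho_{\lambda,o}$ is the induced length metric on $X$ (infimum of lengths of paths). Sequences converging to a point of the Gromov boundary are Cauchy for $\rho_{\lambda,o}$, and $\rho_{\lambda,o}$ on $\partial X$ denotes the extension $\rho_{\lambda,o}(\xi,\eta)=\lim\rho_{\lambda,o}(x_n,y_n)$ for $x_n\to\xi$,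 $y_n\to\eta$. *)

(* Defs.v *)
From mathcomp Require Import all_boot all_order all_algebra.
From mathcomp Require Import all_classical all_reals all_analysis.
Set Implicit Arguments.
Unset Strict Implicit.
Unset Printing Implicit Defensive.
Import Order.TTheory GRing.Theory Num.Theory.
Import numFieldNormedType.Exports.
Local Open Scope classical_set_scope.
Local Open Scope ring_scope.

(* Loops and multiple edges are allowed, and there is no finiteness or local
   finiteness assumption.  The orientation of the edges only serves to
   parametrize each of them by [0, 1]. *)
Record graph := Graph {
  gvertex : Type;
  gedge : Type;
  gsrc : gedge -> gvertex;
  gtgt : gedge -> gvertex }.

(* Points of the geometric realization: Inner e t is the point of parameter t
   in the open edge e. *)
Inductive gpoint (R : realType) (X : graph) : Type :=
| Vertex of gvertex X
| Inner (e : gedge X) (t : R) of 0 < t < 1.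

(* The point p has parameter s in the closed edge e (both end points of a loop
   are the same vertex, which then has the two parameters 0 and 1). *)
Inductive on_edge (R : realType) (X : graph) (e : gedge X) :
    gpoint R X -> R -> Prop :=
| on_src : on_edge e (Vertex R (gsrc e)) 0
| on_tgt : on_edge e (Vertex R (gtgt e)) 1
| on_inner (t : R) (ht : 0 < t < 1) : on_edge e (Inner e ht) t.

Section LengthMetrics.
Variables (R : realType) (X : graph).
Implicit Types (w : gedge X -> R) (p q r o : gpoint R X) (e : gedge X).

(* path_length w p q l: some path from p to q that is a finite concatenation of
   segments, each inside one closed edge, has length l when every edge e is
   given the length w e. *)
Inductive path_length w : gpoint R X -> gpoint R X -> R -> Prop :=
| path_refl p : path_length w p p 0
| path_step p q r e (s t l : R) :
    on_edge e p s -> on_edge e q t -> path_length w q r l ->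
    path_length w p r (w e * `|t - s| + l).

Definition length_dist w p q : R := inf [set l | path_length w p q l].

Definition dist : gpoint R X -> gpoint R X -> R := length_dist (fun=> 1).

Definition connected_graph : Prop :=
  forall p q, exists l, path_length (fun=> 1) p q l.

Definition gromov_prod o p q : R := (dist o p + dist o q - dist p q) / 2.

Definition hyperbolic (delta : R) : Prop := forall o p q r,
  Num.min (gromov_prod o p r) (gromov_prod o r q) - delta <= gromov_prod o p q.

Definition dist_edge o e : R :=
  inf [set dist o p | p in [set p | exists s, on_edge e p s]].

Definition floyd_dist (lambda : R) o : gpoint R X -> gpoint R X -> R :=
  length_dist (fun e => lambda `^ dist_edge o e).

Section Boundary.
Variable o : gpoint R X.

Definition gromov_equiv (x y : nat -> gpoint R X) : Prop :=
  gromov_prod o (x ij.1) (y ij.2) @[ij --> (\oo, \oo)] --> +oo.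

Definition gromov_seq (x : nat -> gpoint R X) : Prop := gromov_equiv x x.

Definition boundary : Type :=
  {xi : set (nat -> gpoint R X) |
    exists2 x, gromov_seq x & xi = [set y | gromov_seq y /\ gromov_equiv x y]}.

Definition converges (x : nat -> gpoint R X) (xi : boundary) : Prop := sval xi x.

Definition boundary_prod (xi eta : boundary) : \bar R :=
  ereal_sup [set limf_einf (fun ij : nat * nat =>
                   (gromov_prod o (xy.1 ij.1) (xy.2 ij.2))%:E) (filter_prod \oo \oo)
            | xy in [set xy : (nat -> gpoint R X) * (nat -> gpoint R X) |
                       converges xy.1 xi /\ converges xy.2 eta]].

(* boundary_prod xi xi = +oo, hence visual_kernel a xi xi = 0 for a > 0. *)
Definition visual_kernel (a : R) (xi eta : boundary) : R :=
  fine (expeR (- (a%:E * boundary_prod xi eta)))%E.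

Definition visual_metric (a : R) (xi eta : boundary) : R :=
  inf [set S | exists (n : nat) (c : nat -> boundary),
    [/\ (0 < n)%N, c 0%N = xi, c n = eta &
        S = \sum_(i < n) visual_kernel a (c i) (c i.+1)]].

(* The common limit of floyd_dist lambda o (x n) (y n) over all sequences x, y
   converging to xi, eta. *)
Definition floyd_metric (lambda : R) (xi eta : boundary) : R :=
  get [set r : R | forall x y : nat -> gpoint R X,
    converges x xi -> converges y eta ->
    floyd_dist lambda o (x n) (y n) @[n --> \oo] --> r].

End Boundary.
End LengthMetrics.

(* Main.v *)
Require Import Defs.
From mathcomp Require Import all_boot all_order all_algebra.
From mathcomp Require Import all_classical all_reals all_analysis.
From mathcomp Require Import lra.
Set Implicit Arguments.
Unset Strict Implicit.
Unset Printing Implicit Defensive.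
Import Order.TTheory GRing.Theory Num.Theory.
Import numFieldNormedType.Exports.
Local Open Scope classical_set_scope.
Local Open Scope ring_scope.

(** Write K(p, q) = exp(- a (p|q)) for points p, q of the graph and rho for the
    Floyd distance with parameter exp(- a).  The theorem follows from a
    two-sided comparison of K and rho inside the graph, transported to the
    boundary by taking limits.

    Upper bound for rho ([floyd_le_kernel]): a point z at arc length s on a
    nearly shortest path from p to q satisfies
    d(o, z) >= (p|q) + |s - m| - 1 with m = d(o, p) - (p|q), by the triangle
    inequality alone.  Integrating exp(- a d(o, z)) along the path gives
    rho(p, q) <= C K(p, q).

    Lower bound for rho ([kernel_le_floyd]): cut an arbitrary path from p to q
    into pieces of length about 1.  A piece that starts at x costs about
    exp(- a d(o, x)) in the Floyd metric, and K between its two ends is at most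
    a constant times that, so the chain of the cut points has K-sum at most
    C times the Floyd length of the path, except for the last, incomplete piece
    ([path_chain]).  Hyperbolicity says that K is a quasi-ultrametric of
    constant exp(a delta); when exp(2 a delta) <= 2, the chain lemma of Frink
    ([frink_chain]) bounds K(p, q) by twice the K-sum of any chain.  Hence
    K(p, q) <= C rho(p, q) + C' exp(- a d(o, q)), and the error term disappears
    when q tends to the boundary.

    The first bound shows that equivalent Gromov sequences are asymptotic for
    rho, so the limit that defines the Floyd metric on the boundary exists
    ([floyd_metric_cvg]).  In the limit, the visual kernel and the Floyd metric
    are equivalent.  The visual metric is below its kernel, by the one-step
    chain, and the triangle inequality of the Floyd metric along a chain gives
    the other direction. *)

(** * Paths and their length metrics *)

Section Paths.
Variables (R : realType) (X : graph).
Implicit Types (w : gedge X -> R) (p q r o : gpoint R X) (e : gedge X).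

Lemma on_edge_itv e p (s : R) : on_edge e p s -> 0 <= s <= 1.
Proof.
by case=> [||t /andP[t0 t1]]; rewrite ?lexx ?ler01// ltW// ltW.
Qed.

Lemma param_dist_le1 e p q (s t : R) :
  on_edge e p s -> on_edge e q t -> `|t - s| <= 1.
Proof.
move=> /on_edge_itv/andP[? ?] /on_edge_itv/andP[? ?].
by rewrite ler_norml; apply/andP; split; lra.
Qed.

Lemma path_length_edge w e p q (s t : R) :
  on_edge e p s -> on_edge e q t -> path_length w p q (w e * `|t - s|).
Proof.
move=> ps qt; rewrite -[_ * _]addr0.
by apply: path_step ps qt _; apply: path_refl.
Qed.

Lemma path_length_cat w p q r (l1 l2 : R) :
  path_length w p q l1 -> path_length w q r l2 ->
  path_length w p r (l1 + l2).
Proof.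
elim=> [p'|p' q' r' e s t l ps qt _ IH] H2; first by rewrite add0r.
by rewrite -addrA; apply: path_step ps qt _; apply: IH.
Qed.

Lemma path_length_sym w p q (l : R) : path_length w p q l -> path_length w q p l.
Proof.
elim=> [p'|p' q' r' e s t l' ps qt _ IH]; first exact: path_refl.
rewrite addrC; apply: (path_length_cat IH).
by rewrite distrC; apply: path_length_edge.
Qed.

(** Connectedness is stated for unit edges; this carries it over to the Floyd
    weights. *)
Lemma path_reweight w w' p q (l : R) :
  path_length w p q l -> exists l', path_length w' p q l'.
Proof.
elim=> [p'|p' q' r' e s t l' ps qt _ [l'' IH]].
  by exists 0; apply: path_refl.
by exists (w' e * `|t - s| + l''); apply: path_step ps qt IH.
Qed.

Section Nonneg.
Variable w : gedge X -> R.
Hypothesis w_ge0 : forall e, 0 <= w e.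

Lemma path_length_ge0 p q (l : R) : path_length w p q l -> 0 <= l.
Proof.
elim=> // p' q' r' e s t l' ps qt _ IH.
by rewrite addr_ge0// mulr_ge0.
Qed.

Lemma length_dist_ge0 p q : 0 <= length_dist w p q.
Proof.
rewrite /length_dist; have [->|/set0P ne] := eqVneq [set l | path_length w p q l] set0.
  by rewrite inf0.
by apply: lb_le_inf => // l; apply: path_length_ge0.
Qed.

Lemma length_dist_le p q (l : R) : path_length w p q l -> length_dist w p q <= l.
Proof.
move=> pl; apply: ge_inf => //.
by exists 0 => m; apply: path_length_ge0.
Qed.

Lemma length_dist_refl p : length_dist w p p = 0.
Proof.
by apply/eqP; rewrite eq_le length_dist_ge0 andbT length_dist_le//; apply: path_refl.
Qed.

Lemma length_dist_sym p q : length_dist w p q = length_dist w q p.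
Proof.
by rewrite /length_dist; congr inf; apply/seteqP; split=> l; apply: path_length_sym.
Qed.

Hypothesis Xconn : connected_graph R X.

Lemma near_shortest_path p q (eps : R) : 0 < eps ->
  exists2 l, path_length w p q l & l < length_dist w p q + eps.
Proof.
move=> e0; apply: inf_adherent => //; split.
  by have [l pl] := Xconn p q; apply: path_reweight pl.
by exists 0 => m; apply: path_length_ge0.
Qed.

Lemma length_dist_triangle q p r :
  length_dist w p r <= length_dist w p q + length_dist w q r.
Proof.
apply/ler_addgt0Pr => eps e0.
have e2 : 0 < eps / 2 by lra.
have [l1 p1 h1] := near_shortest_path p q e2.
have [l2 p2 h2] := near_shortest_path q r e2.
have := length_dist_le (path_length_cat p1 p2); lra.
Qed.

End Nonneg.

Lemma dist_ge0 p q : 0 <= dist p q. Proof. exact: length_dist_ge0. Qed.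
Lemma dist_refl p : dist p p = 0. Proof. exact: length_dist_refl. Qed.
Lemma dist_sym p q : dist p q = dist q p. Proof. exact: length_dist_sym. Qed.

Lemma dist_on_edge e p q (s t : R) :
  on_edge e p s -> on_edge e q t -> dist p q <= `|t - s|.
Proof.
move=> ps qt; apply: (length_dist_le (w := fun=> 1)) => //.
by have := path_length_edge (fun=> 1) ps qt; rewrite mul1r.
Qed.

Lemma gromov_prodxx o p : gromov_prod o p p = dist o p.
Proof. by rewrite /gromov_prod dist_refl; lra. Qed.

Lemma gromov_prod_sym o p q : gromov_prod o p q = gromov_prod o q p.
Proof. by rewrite /gromov_prod (dist_sym p q) [X in X - _]addrC. Qed.

Section Connected.
Hypothesis Xconn : connected_graph R X.

Lemma dist_triangle q p r : dist p r <= dist p q + dist q r.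
Proof. exact: length_dist_triangle. Qed.

Lemma gromov_prod_ge0 o p q : 0 <= gromov_prod o p q.
Proof.
have := dist_triangle o p q; rewrite (dist_sym p o) /gromov_prod; lra.
Qed.

(** The map q |-> (p|q) is 1-Lipschitz, with value d(o, p) at q = p. *)
Lemma gromov_prod_ge o p q : dist o p - dist p q <= gromov_prod o p q.
Proof. have := dist_triangle q o p; rewrite (dist_sym q p) /gromov_prod; lra. Qed.

(** With [dist_edge_ge], this compares the Floyd weight of an edge, up to the
    factor exp a, with exp(- a d(o, p)) for every point p of the edge. *)
Lemma dist_edge_le o e p (s : R) : on_edge e p s -> dist_edge o e <= dist o p.
Proof.
move=> ps; apply: ge_inf; first by exists 0 => _ [q _ <-]; apply: dist_ge0.
by exists p => //; exists s.
Qed.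

Lemma dist_edge_ge o e p (s : R) : on_edge e p s -> dist o p - 1 <= dist_edge o e.
Proof.
move=> ps; apply: lb_le_inf; first by exists (dist o p); exists p => //; exists s.
move=> _ [q [t qt] <-]; have := dist_triangle q o p.
have := dist_on_edge qt ps.
have := param_dist_le1 qt ps; lra.
Qed.

End Connected.
End Paths.

(** * Chains in a quasi-ultrametric space *)

Section ChainLemma.
Variables (R : realFieldType) (T : Type) (K : T -> T -> R).

Fixpoint chain_sum (x : T) (s : seq T) : R :=
  if s is y :: s' then K x y + chain_sum y s' else 0.

Lemma chain_sum_cat x s1 y s2 :
  chain_sum x (s1 ++ y :: s2) =
  chain_sum x s1 + K (last x s1) y + chain_sum y s2.
Proof.
by elim: s1 x => [|z s1 IH] x /=; rewrite ?add0r// IH !addrA.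
Qed.

Hypothesis K_ge0 : forall x y, 0 <= K x y.

Lemma chain_sum_ge0 x s : 0 <= chain_sum x s.
Proof. by elim: s x => //= y s IH x; rewrite addr_ge0. Qed.

(** One step of a chain can be singled out so that what precedes and what
    follows weigh at most m and at most the total minus m: it is the step
    during which the partial sums reach m. *)
Lemma chain_split x s (m : R) : (0 < size s)%N -> 0 <= m <= chain_sum x s ->
  exists s1 y s2, [/\ s = s1 ++ y :: s2, chain_sum x s1 <= m &
                      chain_sum y s2 <= chain_sum x s - m].
Proof.
elim: s x m => // y s IH x m _ /=.
have [le_m|gt_m] := lerP m (K x y).
  by move=> /andP[m0 _]; exists [::], y, s; split => //=; lra.
move=> /andP[m0 mS]; have [||s1 [z [s2 [-> h1 h2]]]] := IH y (m - K x y).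
- by case: s mS {IH} => //=; lra.
- by apply/andP; split; lra.
- by exists (y :: s1), z, s2; split => //=; lra.
Qed.

(** Frink's argument.  Split the chain at a step such that both remaining parts
    have sum at most S / 2; by induction K is at most S between the ends of each
    part, and it is at most S on the step itself since S contains that term.
    Two applications of the quasi-ultrametric inequality give c ^ 2 * S <= 2 S.
    An empty part has no inductive bound, because K x x need not be small, but
    then one application of the inequality is saved. *)
Lemma frink_chain (c : R) : 0 <= c -> c ^+ 2 <= 2 ->
  (forall x y z, K x z <= c * Num.max (K x y) (K y z)) ->
  forall x s, (0 < size s)%N -> K x (last x s) <= 2 * chain_sum x s.
Proof.
move=> c0 c2 Kmax x s.
have cle2 : c <= 2 by nra.
have [n] := ubnP (size s); elim: n x s => // n IH x s; rewrite ltnS => sn s0.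
have S0 := chain_sum_ge0 x s; set S := chain_sum x s in S0 *.
have [|s1 [y [s2 [es h1 h2]]]] := @chain_split x s (S / 2) s0.
  by apply/andP; split; rewrite -/S; lra.
have KxyS : K (last x s1) y <= S.
  rewrite /S es chain_sum_cat.
  by have := chain_sum_ge0 x s1; have := chain_sum_ge0 y s2; lra.
have max_le (u v t : R) : u <= t -> v <= t -> c * Num.max u v <= c * t.
  by move=> ut vt; rewrite ler_wpM2l// ge_max ut.
have [sz1 sz2] : (size s1 < n)%N /\ (size s2 < n)%N.
  by move: sn; rewrite es size_cat /= addnS => sn; split;
    apply: leq_trans sn; rewrite ltnS ?leq_addr ?leq_addl.
have right_le : K (last x s1) (last y s2) <= Num.max 1 c * S.
  case: s2 sz2 h2 {es} => [|z s2] sz2 h2 /=.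
    by apply: (le_trans KxyS); rewrite ler_peMl// le_max lexx.
  have /= IHr := IH y (z :: s2) sz2 isT.
  apply: le_trans (Kmax _ y _) _; apply: le_trans (max_le _ _ S _ _) _ => //.
    by rewrite -/S in h2; move: h2 IHr => /=; lra.
  by rewrite ler_wpM2r// le_max lexx orbT.
rewrite es last_cat /=.
have M2 : Num.max 1 c * S <= 2 * S by rewrite ler_wpM2r// ge_max cle2 andbT; lra.
case: s1 sz1 h1 {es KxyS} right_le => [|z s1] sz1 h1 /= right_le.
  exact: le_trans right_le M2.
have /= IHl := IH x (z :: s1) sz1 isT.
apply: le_trans (Kmax _ (last z s1) _) _.
apply: le_trans (max_le _ _ (Num.max 1 c * S) _ right_le) _.
  by apply: (@le_trans _ _ S); [move: h1 IHl => /=; lra|rewrite ler_peMl// le_max lexx].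
rewrite mulrA ler_wpM2r// maxr_pMr// mulr1 ge_max cle2.
by rewrite -expr2.
Qed.

End ChainLemma.

(** * The Floyd distance and the Gromov product inside the graph *)

Definition gromov_kernel (R : realType) (X : graph) (o : gpoint R X) (a : R)
    (p q : gpoint R X) : R :=
  expR (- (a * gromov_prod o p q)).

Section FloydOnGraph.
Variables (R : realType) (X : graph) (o : gpoint R X) (a : R).
Hypothesis (a_gt0 : 0 < a) (Xconn : connected_graph R X).
Implicit Types (p q r : gpoint R X) (e : gedge X).

Let w e : R := expR (- a) `^ dist_edge o e.
Local Notation rho := (floyd_dist (expR (- a)) o).
Local Notation K := (gromov_kernel o a).

Let w_ge0 e : 0 <= w e. Proof. exact: powR_ge0. Qed.

Let wE e : w e = expR (- (a * dist_edge o e)).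
Proof. by rewrite /w -expRM mulNr. Qed.

Let w_le e p (s : R) : on_edge e p s -> w e <= expR a * expR (- (a * dist o p)).
Proof.
move=> ps; rewrite wE -expRD ler_expR.
have := dist_edge_ge Xconn o ps; rewrite -(ler_pM2l a_gt0); lra.
Qed.

Let w_ge e p (s : R) : on_edge e p s -> expR (- (a * dist o p)) <= w e.
Proof.
move=> ps; rewrite wE ler_expR lerN2 ler_pM2l//.
exact: dist_edge_le ps.
Qed.

(** Along a path of length l ending at r, the point at remaining length u is at
    distance at least d(o, r) - u from o, so that the Floyd length is at most a
    constant times the integral of exp(a u) over [0, l].  The induction needs
    the sharper factor exp(a l) - 1. *)
Lemma floyd_le_endpoint p r (l : R) : path_length (fun=> 1) p r l ->
  rho p r <= expR a / a * expR (- (a * dist o r)) * expR (a * l).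
Proof.
move=> plr; suff [f pf fle] : exists2 f, path_length w p r f &
    f <= expR a / a * expR (- (a * dist o r)) * (expR (a * l) - 1).
  apply: le_trans (length_dist_le w_ge0 pf) _; apply: (le_trans fle).
  by rewrite ler_pM2l ?gerBl// !mulr_gt0 ?expR_gt0 ?invr_gt0.
elim: plr => {p r l} [p|p q r e s t l ps qt pl [f pf IH]].
  by exists 0; [apply: path_refl|rewrite mulr0 expR0 subrr mulr0].
exists (w e * `|t - s| + f); first exact: path_step ps qt pf.
set tau := `|t - s|; set A := expR a / a * _ in IH *.
have A0 : 0 < A by rewrite !mulr_gt0 ?expR_gt0 ?invr_gt0.
have Aa : A * a = expR a * expR (- (a * dist o r)).
  by rewrite /A mulrAC divfK ?gt_eqF.
have wle : w e <= A * a * expR (a * l).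
  apply: le_trans (w_le qt) _; rewrite Aa -!expRD ler_expR.
  have le_or : dist o r <= dist o q + l.
    have := dist_triangle Xconn q o r.
    have : dist q r <= l by exact: (length_dist_le (w := fun=> 1)).
    lra.
  by move: le_or; rewrite -(ler_pM2l a_gt0); lra.
rewrite mul1r (mulrDr a) expRD.
have tau0 : 0 <= tau by exact: normr_ge0.
(* the step of length tau is paid for by exp(a tau) >= 1 + a tau *)
have := expR_ge1Dx (a * tau); have := expR_gt0 (a * l).
set L := expR (a * l) in wle IH *; set Et := expR (a * tau) => L0 Ege.
have h1 : w e * tau <= A * a * L * tau by rewrite ler_wpM2r.
have h2 : A * L * (1 + a * tau) <= A * L * Et by rewrite ler_pM2l// mulr_gt0.
lra.
Qed.

(** Paths are only cut at the ends of their segments, which have length at most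
    1; hence the tolerance on the position of the cut. *)
Lemma path_split p r (l m : R) : path_length (fun=> 1) p r l -> 0 <= m <= l ->
  exists z l1 l2, [/\ path_length (fun=> 1) p z l1, path_length (fun=> 1) z r l2,
                      l1 + l2 = l & m - 1 <= l1 <= m + 1].
Proof.
move=> plr; elim: plr m => {p r l} [p|p q r e s t l ps qt pl IH] m /andP[m0 ml].
  exists p, 0, 0; split; rewrite ?addr0//; try exact: path_refl.
  by apply/andP; split; lra.
set tau := `|t - s| in ml *.
have [m_le|m_gt] := lerP m tau.
  exists p, 0, (1 * tau + l); split; rewrite ?add0r//; first exact: path_refl.
    exact: path_step ps qt pl.
  have := param_dist_le1 ps qt; rewrite -/tau => tau1.
  by apply/andP; split; lra.
have [|z [l1 [l2 [p1 p2 el /andP[h1 h2]]]]] := IH (m - tau).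
  by apply/andP; split; lra.
exists z, (1 * tau + l1), l2; split=> //.
- exact: path_step ps qt p1.
- by rewrite -addrA el.
- by apply/andP; split; lra.
Qed.

(** Cut a nearly shortest path from p to q at the arc length m where the lower
    bounds d(o, p) - s and d(o, q) - (l - s) for the distance to o meet; their
    common value there is about (p|q).  Each half is then estimated by
    [floyd_le_endpoint] from its outer end. *)
Lemma floyd_le_kernel p q : rho p q <= 2 * expR (3 * a) / a * K p q.
Proof.
have [l pl lt_l] := near_shortest_path (w := fun=> 1) (fun=> ler01) Xconn p q ltr01.
rewrite -/(dist p q) in lt_l.
have le_l : dist p q <= l by exact: (length_dist_le (w := fun=> 1)).
pose m := dist o p - gromov_prod o p q.
have m_itv : 0 <= m <= l.
  have := gromov_prod_ge Xconn o q p; have := gromov_prod_ge Xconn o p q.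
  have := dist_triangle Xconn p o q; have := dist_triangle Xconn q o p.
  rewrite /m (gromov_prod_sym o q p) (dist_sym q p) /gromov_prod => h1 h2 h3 h4.
  by apply/andP; split; lra.
have [z [l1 [l2 [p1 p2 el /andP[h1 h2]]]]] := path_split pl m_itv.
(* 2: one unit for the inexact cut, one for the path being only nearly shortest *)
have kernel_bound x l' : dist o x - gromov_prod o p q + 2 >= l' ->
    expR a / a * expR (- (a * dist o x)) * expR (a * l') <=
    expR (3 * a) / a * K p q.
  move=> le_l'; rewrite mulrAC -!mulrA ![_ * (a^-1 * _)]mulrCA ler_pM2l ?invr_gt0//.
  rewrite /gromov_kernel -!expRD ler_expR.
  by move: le_l'; rewrite -(ler_pM2l a_gt0); lra.
have rho1 : rho p z <= expR (3 * a) / a * K p q.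
  rewrite /floyd_dist length_dist_sym.
  apply: le_trans (floyd_le_endpoint (path_length_sym p1)) _.
  by apply: kernel_bound; rewrite /m in h2; lra.
have rho2 : rho z q <= expR (3 * a) / a * K p q.
  apply: le_trans (floyd_le_endpoint p2) _; apply: kernel_bound.
  by move: h1; rewrite /m /gromov_prod; lra.
apply: le_trans (length_dist_triangle w_ge0 Xconn z _ _) _.
rewrite -/(rho p z) -/(rho z q); lra.
Qed.

Lemma kernel_le p q : K p q <= expR (a * dist p q) * expR (- (a * dist o p)).
Proof.
rewrite /gromov_kernel -expRD ler_expR.
by have := gromov_prod_ge Xconn o p q; rewrite -(ler_pM2l a_gt0); lra.
Qed.

(** The chain is built greedily.  The point p is the last cut point, and h <= 1
    is the length travelled from p to the current point q, so that
    h exp(- a (d(o, p) + 1)) is a lower bound for the Floyd length already spent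
    since the last cut.  A new cut is made as soon as h exceeds 1; the final
    incomplete piece accounts for the last summand. *)
Lemma path_chain q r (f : R) : path_length w q r f ->
  forall p (h : R), 0 <= h <= 1 -> dist p q <= h ->
  exists s, [/\ (0 < size s)%N, last p s = r &
    chain_sum K p s <=
      expR (3 * a) * (f + h * expR (- (a * (dist o p + 1)))) +
      expR a * expR (- (a * dist o r))].
Proof.
elim=> {q r f} [r|q q' r e s t f qs q't pl IH] p h /andP[h0 h1] dpq.
  exists [:: r]; split => //=; rewrite addr0 add0r.
  have Krp : K p r <= expR a * expR (- (a * dist o r)).
    rewrite /gromov_kernel gromov_prod_sym; apply: le_trans (kernel_le r p) _.
    by rewrite ler_pM2r ?expR_gt0// ler_expR ger_pMr// dist_sym; lra.
  have : 0 <= expR (3 * a) * (h * expR (- (a * (dist o p + 1)))).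
    by rewrite !mulr_ge0// ltW// expR_gt0.
  lra.
set tau := `|t - s|; set E := expR (- (a * (dist o p + 1))).
have tau0 : 0 <= tau by exact: normr_ge0.
have tau1 : tau <= 1 by exact: param_dist_le1 qs q't.
have dpq' : dist p q' <= h + tau.
  have := dist_triangle Xconn q p q'; have := dist_on_edge qs q't.
  by rewrite -/tau; lra.
have E_le : E <= w e.
  apply: le_trans (w_ge qs); rewrite /E ler_expR lerN2 ler_pM2l//.
  by have := dist_triangle Xconn p o q; lra.
have Etau : E * tau <= w e * tau by rewrite ler_wpM2r.
(* either the current piece goes on, or q' is the next cut point *)
have [short|long] := lerP (h + tau) 1.
  have [|s' [s0 ls sum_le]] := IH p (h + tau) _ dpq'; first by apply/andP; split; lra.
  exists s'; split=> //; apply: (le_trans sum_le); rewrite lerD2r ler_pM2l ?expR_gt0//.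
  by rewrite -/E; lra.
have [||s' [s0 ls sum_le]] := IH q' 0 _ _; rewrite ?dist_refl ?lexx ?ler01//.
exists (q' :: s'); split=> //=.
have Kle : K p q' <= expR (3 * a) * E.
  apply: le_trans (kernel_le p q') _; rewrite /E -!expRD ler_expR.
  have : dist p q' <= 2 by lra.
  by rewrite -(ler_pM2l a_gt0); lra.
have : expR (3 * a) * E <= expR (3 * a) * (w e * tau + h * E).
  rewrite ler_pM2l ?expR_gt0//.
  have E0 : 0 < E by exact: expR_gt0.
  have : 1 * E <= (h + tau) * E by rewrite ler_pM2r// ltW.
  lra.
by rewrite mul0r addr0 in sum_le; lra.
Qed.

Variable delta : R.
Hypotheses (Xhyp : hyperbolic X delta) (a_small : expR (2 * (a * delta)) <= 2).

Lemma kernel_quasi_ultra p q r : 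
  K p r <= expR (a * delta) * Num.max (K p q) (K q r).
Proof.
have := Xhyp o p r q; set m := Num.min _ _ => h.
suff -> : Num.max (K p q) (K q r) = expR (- (a * m)).
  by rewrite -expRD ler_expR; move: h; rewrite -(ler_pM2l a_gt0); lra.
rewrite /m /gromov_kernel; have [le|lt] := lerP (gromov_prod o p q) (gromov_prod o q r).
  by apply/max_idPl; rewrite ler_expR lerN2 ler_pM2l.
by apply/max_idPr; rewrite ler_expR lerN2 ler_pM2l// ltW.
Qed.

(** The last summand cannot be dropped, as K(p, p) = exp(- a d(o, p)) does not
    vanish. *)
Lemma kernel_le_floyd p q :
  K p q <= 2 * expR (3 * a) * rho p q + 2 * expR a * expR (- (a * dist o q)).
Proof.
apply/ler_addgt0Pr => eps eps0.
have e0 : 0 < eps / (2 * expR (3 * a)) by rewrite divr_gt0// mulr_gt0// expR_gt0.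
have [f pf lt_f] := near_shortest_path w_ge0 Xconn p q e0.
have [||s [s0 ls sum_le]] := path_chain pf (p := p) (h := 0) _ _; rewrite ?dist_refl ?lexx ?ler01//.
have frink : K p q <= 2 * chain_sum K p s.
  rewrite -[in K p q]ls; apply: (@frink_chain _ _ K _ (expR (a * delta))) => //.
  - by move=> x y; exact: expR_ge0.
  - by rewrite expr2 -expRD; apply: le_trans a_small; rewrite ler_expR; lra.
  - by move=> x y z; apply: kernel_quasi_ultra.
apply: (le_trans frink).
rewrite mul0r addr0 in sum_le.
have : 2 * expR (3 * a) * f <= 2 * expR (3 * a) * (rho p q + eps / (2 * expR (3 * a))).
  by rewrite ler_pM2l ?mulr_gt0 ?expR_gt0// ltW.
rewrite mulrDr [X in _ + X]mulrC divfK ?gt_eqF ?mulr_gt0 ?expR_gt0//; lra.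
Qed.

End FloydOnGraph.

(** * Limits along pairs of indices *)

Section PairLimits.

Lemma near_pairP (P : nat * nat -> Prop) :
  (\forall ij \near (\oo, \oo), P ij) <->
  exists N, forall i j, (N <= i)%N -> (N <= j)%N -> P (i, j).
Proof.
split=> [[[A B] /= [[M _ AM] [N _ BN]] ABP]|[N NP]].
  exists (maxn M N) => i j; rewrite !geq_max => /andP[Mi _] /andP[_ Nj].
  by apply: (ABP (i, j)); split; [exact: AM|exact: BN].
exists ([set i | (N <= i)%N], [set j | (N <= j)%N]).
  by split; exists N.
by move=> [i j] [/= Ni Nj]; apply: NP.
Qed.

Variable R : realType.
Implicit Types u : nat * nat -> R.

Lemma limf_einf_pair_ge u (A : R) (N : nat) :
  (forall i j, (N <= i)%N -> (N <= j)%N -> A <= u (i, j)) ->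
  (A%:E <= limf_einf (fun ij => (u ij)%:E) (filter_prod \oo \oo))%E.
Proof.
move=> NA; rewrite limf_einfE; apply: le_ereal_sup_tmp.
pose V := [set ij : nat * nat | (N <= ij.1)%N /\ (N <= ij.2)%N].
exists (ereal_inf ((fun ij => (u ij)%:E) @` V)).
  by exists V => //; apply/near_pairP; exists N.
apply: le_ereal_inf_tmp => _ [[i j] [/= Ni Nj] <-].
by rewrite lee_fin; apply: NA.
Qed.

Lemma limf_einf_pair_gt u (A : R) :
  (A%:E < limf_einf (fun ij => (u ij)%:E) (filter_prod \oo \oo))%E ->
  exists N, forall i j, (N <= i)%N -> (N <= j)%N -> A <= u (i, j).
Proof.
rewrite limf_einfE => /ereal_sup_gt[_ [V FV <-] AV].
have [N NV] := (near_pairP V).1 FV; exists N => i j Ni Nj.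
rewrite -lee_fin; apply: le_trans (ltW AV) _.
by apply: ereal_inf_lbound; exists (i, j) => //; apply: NV.
Qed.

End PairLimits.

(** * Gromov sequences and the Gromov product at infinity *)

Section GromovSequences.
Variables (R : realType) (X : graph) (o : gpoint R X).
Implicit Types (x y z : nat -> gpoint R X) (xi eta : boundary o).

Lemma gromov_equivP x y : gromov_equiv o x y <-> forall A : R, exists N,
  forall i j, (N <= i)%N -> (N <= j)%N -> A <= gromov_prod o (x i) (y j).
Proof.
rewrite /gromov_equiv cvgryPge.
by split=> h A; [apply: (near_pairP _).1 (h A)|apply/near_pairP; apply: h].
Qed.

Lemma gromov_equiv_sym x y : gromov_equiv o x y -> gromov_equiv o y x.
Proof.
move=> /gromov_equivP xy; apply/gromov_equivP => A.
have [N NA] := xy A; exists N => i j Ni Nj.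
by rewrite gromov_prod_sym; apply: NA.
Qed.

Lemma gromov_equiv_trans (delta : R) y x z : hyperbolic X delta ->
  gromov_equiv o x y -> gromov_equiv o y z -> gromov_equiv o x z.
Proof.
move=> Xhyp /gromov_equivP xy /gromov_equivP yz; apply/gromov_equivP => A.
have [M MA] := xy (A + delta); have [N NA] := yz (A + delta).
exists (maxn M N) => i j; rewrite !geq_max => /andP[Mi Ni] /andP[Mj Nj].
apply: le_trans (Xhyp o (x i) (z j) (y (maxn M N))).
rewrite lerBrDr le_min MA ?leq_maxl// NA ?leq_maxr//.
Qed.

Lemma boundary_seq xi : exists x, converges x xi.
Proof.
case: xi => [S [x xx eS]]; exists x; rewrite /converges /= eS.
by split.
Qed.

Lemma converges_equiv (delta : R) xi x y : hyperbolic X delta ->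
  converges x xi -> converges y xi -> gromov_equiv o x y.
Proof.
move=> Xhyp; case: xi => [S [z zz eS]]; rewrite /converges /= eS.
move=> [_ zx] [_ zy]; apply: gromov_equiv_trans Xhyp _ zy.
exact: gromov_equiv_sym.
Qed.

Lemma boundary_prod_ge xi eta x y (A : R) (N : nat) :
  converges x xi -> converges y eta ->
  (forall i j, (N <= i)%N -> (N <= j)%N -> A <= gromov_prod o (x i) (y j)) ->
  (A%:E <= boundary_prod xi eta)%E.
Proof.
move=> cx cy NA; apply: le_ereal_sup_tmp.
eexists; first by exists (x, y).
exact: limf_einf_pair_ge NA.
Qed.

Lemma boundary_prod_gt xi eta (A : R) : (A%:E < boundary_prod xi eta)%E ->
  exists x y N, [/\ converges x xi, converges y eta &
    forall i j, (N <= i)%N -> (N <= j)%N -> A <= gromov_prod o (x i) (y j)].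
Proof.
move=> /ereal_sup_gt[_ [[x y] [/= cx cy] <-]] /limf_einf_pair_gt[N NA].
by exists x, y, N.
Qed.

Lemma boundary_prod_ge0 xi eta : connected_graph R X ->
  (0 <= boundary_prod xi eta)%E.
Proof.
move=> Xconn; have [x cx] := boundary_seq xi; have [y cy] := boundary_seq eta.
apply: (@boundary_prod_ge _ _ x y 0 0) => // i j _ _.
exact: gromov_prod_ge0.
Qed.

End GromovSequences.

(** * The Floyd metric and the visual kernel on the boundary *)

Section FloydOnBoundary.
Variables (R : realType) (X : graph) (o : gpoint R X) (a delta : R).
Hypotheses (a_gt0 : 0 < a) (Xconn : connected_graph R X).
Hypothesis Xhyp : hyperbolic X delta.
Implicit Types (x y z : nat -> gpoint R X) (xi eta zeta : boundary o).

Local Notation rho := (floyd_dist (expR (- a)) o).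
Local Notation K := (gromov_kernel o a).

Lemma expR_surj (v : R) : 0 < v -> exists s, v = expR (- (a * s)).
Proof.
move=> v0; exists (- ln v / a).
by rewrite mulrCA divff ?gt_eqF// mulr1 opprK lnK.
Qed.

Lemma gromov_equiv_kernel x y (eps : R) : gromov_equiv o x y -> 0 < eps ->
  exists N, forall i j, (N <= i)%N -> (N <= j)%N -> K (x i) (y j) <= eps.
Proof.
move=> /gromov_equivP xy /expR_surj[A ->]; have [N NA] := xy A.
exists N => i j Ni Nj; rewrite /gromov_kernel ler_expR lerN2 ler_pM2l//.
exact: NA.
Qed.

Let rho_ge0 p q : 0 <= rho p q.
Proof. by apply: length_dist_ge0 => e; apply: powR_ge0. Qed.

Let rho_triangle q p r : rho p r <= rho p q + rho q r.
Proof. by apply: length_dist_triangle => // e; apply: powR_ge0. Qed.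

Let rho_sym p q : rho p q = rho q p.
Proof. exact: length_dist_sym. Qed.

Lemma gromov_equiv_floyd x y (eps : R) : gromov_equiv o x y -> 0 < eps ->
  exists N, forall i j, (N <= i)%N -> (N <= j)%N -> rho (x i) (y j) <= eps.
Proof.
move=> xy eps0; set C := 2 * expR (3 * a) / a.
have C0 : 0 < C by rewrite !mulr_gt0 ?invr_gt0 ?expR_gt0.
have [N NK] := gromov_equiv_kernel xy (divr_gt0 eps0 C0).
exists N => i j Ni Nj; apply: le_trans (floyd_le_kernel _ a_gt0 Xconn _ _) _.
by rewrite -/C mulrC -ler_pdivlMr// NK.
Qed.

(** Contains both the Cauchy property of rho (x n) (y n) and the independence of
    its limit from the chosen sequences. *)
Lemma floyd_dist_uniform xi eta x x' y y' (eps : R) :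
  converges x xi -> converges x' xi -> converges y eta -> converges y' eta ->
  0 < eps -> exists N, forall i i' j j',
    (N <= i)%N -> (N <= i')%N -> (N <= j)%N -> (N <= j')%N ->
    `|rho (x i) (y j) - rho (x' i') (y' j')| <= eps.
Proof.
move=> cx cx' cy cy' eps0; have e2 : 0 < eps / 2 by lra.
have [M Mx] := gromov_equiv_floyd (converges_equiv Xhyp cx cx') e2.
have [N Ny] := gromov_equiv_floyd (converges_equiv Xhyp cy cy') e2.
exists (maxn M N) => i i' j j'; rewrite !geq_max.
move=> /andP[Mi _] /andP[Mi' _] /andP[_ Nj] /andP[_ Nj'].
have := Mx _ _ Mi Mi'; have := Ny _ _ Nj Nj'.
have := rho_triangle (x' i') (x i) (y j); have := rho_triangle (y' j') (x' i') (y j).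
have := rho_triangle (x i) (x' i') (y' j'); have := rho_triangle (y j) (x i) (y' j').
rewrite (rho_sym (x' i') (x i)) (rho_sym (y' j') (y j)) => *.
by rewrite ler_norml; apply/andP; split; lra.
Qed.

Lemma floyd_metric_cvg xi eta x y : converges x xi -> converges y eta ->
  rho (x n) (y n) @[n --> \oo] --> floyd_metric (expR (- a)) xi eta.
Proof.
move=> cx cy; rewrite /floyd_metric.
have /getPex : exists r : R, forall x y, converges x xi -> converges y eta ->
    rho (x n) (y n) @[n --> \oo] --> r; last by apply.
have /cvg_ex[r cvg_r] : cvg (rho (x n) (y n) @[n --> \oo]).
  apply: cauchy_cvg; apply: cauchy_exP => eps eps0; have e2 : 0 < eps / 2 by lra.
  have [N NN] := floyd_dist_uniform cx cx cy cy e2.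
  exists (rho (x N) (y N)); exists N => // n /= Nn.
  by rewrite /ball /=; have := NN N n N n (leqnn _) Nn (leqnn _) Nn; lra.
exists r => x' y' cx' cy'; apply/cvgrPdist_le => eps eps0.
have e2 : 0 < eps / 2 by lra.
have /cvgrPdist_le/(_ _ e2)[M _ Mr] := cvg_r.
have [N NN] := floyd_dist_uniform cx cx' cy cy' e2.
exists (maxn M N) => // n /=; rewrite geq_max => /andP[Mn Nn].
have := Mr n Mn; have := NN n n n n Nn Nn Nn Nn => /= h1 h2.
apply: le_trans (ler_distD (rho (x n) (y n)) _ _) _; lra.
Qed.

(** The Gromov product at infinity is a lower limit over independent indices, so
    convergence along the diagonal is not enough to compare with it. *)
Lemma floyd_metric_pair_cvg xi eta x y (eps : R) :
  converges x xi -> converges y eta -> 0 < eps ->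
  exists N, forall i j, (N <= i)%N -> (N <= j)%N ->
    `|rho (x i) (y j) - floyd_metric (expR (- a)) xi eta| <= eps.
Proof.
move=> cx cy eps0; have e2 : 0 < eps / 2 by lra.
have /cvgrPdist_le/(_ _ e2)[M _ Mr] := floyd_metric_cvg cx cy.
have [N NN] := floyd_dist_uniform cx cx cy cy e2.
exists N => i j Ni Nj; set k := maxn M N.
have := Mr k (leq_maxl _ _); rewrite distrC.
have := NN i k j k Ni (leq_maxr _ _) Nj (leq_maxr _ _) => /= h1 h2.
apply: le_trans (ler_distD (rho (x k) (y k)) _ _) _; lra.
Qed.

Lemma floyd_metric_ge0 xi eta : 0 <= floyd_metric (expR (- a)) xi eta.
Proof.
have [x cx] := boundary_seq xi; have [y cy] := boundary_seq eta.
apply: cvgr_to_ge (floyd_metric_cvg cx cy) _.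
by apply: nearW => n; apply: rho_ge0.
Qed.

Lemma floyd_metric_triangle eta xi zeta :
  floyd_metric (expR (- a)) xi zeta <=
  floyd_metric (expR (- a)) xi eta + floyd_metric (expR (- a)) eta zeta.
Proof.
have [x cx] := boundary_seq xi; have [y cy] := boundary_seq eta.
have [z cz] := boundary_seq zeta.
apply: ler_cvg_to (floyd_metric_cvg cx cz)
  (cvgD (floyd_metric_cvg cx cy) (floyd_metric_cvg cy cz)) _.
by apply: nearW => n; apply: rho_triangle.
Qed.

Lemma visual_kernelP (r : R) xi eta : boundary_prod xi eta = r%:E ->
  visual_kernel a xi eta = expR (- (a * r)).
Proof. by rewrite /visual_kernel => ->. Qed.

Lemma visual_kernel_infty xi eta : boundary_prod xi eta = +oo%E ->
  visual_kernel a xi eta = 0.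
Proof. by rewrite /visual_kernel => ->; rewrite gt0_muley ?lte_fin. Qed.

Lemma visual_kernel_ge0 xi eta : 0 <= visual_kernel a xi eta.
Proof. by apply: fine_ge0; apply: expeR_ge0. Qed.

Lemma visual_kernel_le xi eta (s : R) : (s%:E <= boundary_prod xi eta)%E ->
  visual_kernel a xi eta <= expR (- (a * s)).
Proof.
case E : (boundary_prod xi eta) => [r| |] //.
  by rewrite (visual_kernelP E) lee_fin ler_expR lerN2 ler_pM2l.
by rewrite (visual_kernel_infty E) expR_ge0.
Qed.

(** The Gromov product at infinity need not be attained, nor finite: estimates by
    exp(- a s) for all s below it pass to the kernel by continuity of the
    exponential. *)
Lemma le_visual_kernel xi eta (C v : R) : 0 < C ->
  (forall s : R, (s%:E < boundary_prod xi eta)%E -> v <= C * expR (- (a * s))) ->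
  v <= C * visual_kernel a xi eta.
Proof.
move=> C0 v_le; rewrite leNgt; apply/negP => v_gt.
have v0 : 0 < v.
  by apply: le_lt_trans v_gt; rewrite mulr_ge0 ?visual_kernel_ge0// ltW.
have [s es] := expR_surj (divr_gt0 v0 C0).
have ev : v = C * expR (- (a * s)) by rewrite -es mulrC divfK ?gt_eqF.
have [t st tB] : exists2 t, s < t & (t%:E < boundary_prod xi eta)%E.
  move: v_gt; case E : (boundary_prod xi eta) => [r| |].
  - rewrite (visual_kernelP E) ev ltr_pM2l// ltr_expR ltrN2 ltr_pM2l// => sr.
    by exists ((s + r) / 2); rewrite ?lte_fin; lra.
  - by move=> _; exists (s + 1); rewrite ?ltry//; lra.
  - by have := boundary_prod_ge0 xi eta Xconn; rewrite E.
have := v_le t tB; rewrite ev ler_pM2l// ler_expR lerN2 ler_pM2l//; lra.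
Qed.

Lemma floyd_metric_le_visual_kernel xi eta :
  floyd_metric (expR (- a)) xi eta <=
  2 * expR (3 * a) / a * visual_kernel a xi eta.
Proof.
set C := 2 * expR (3 * a) / a.
have C0 : 0 < C by rewrite !mulr_gt0 ?invr_gt0 ?expR_gt0.
apply: le_visual_kernel => // s /boundary_prod_gt[x [y [N [cx cy Ns]]]].
apply: cvgr_to_le (floyd_metric_cvg cx cy) _.
exists N => // n /= Nn; apply: le_trans (floyd_le_kernel _ a_gt0 Xconn _ _) _.
by rewrite -/C ler_pM2l// ler_expR lerN2 ler_pM2l// Ns.
Qed.

Lemma floyd_metric_le_chain (c : nat -> boundary o) (n : nat) : (0 < n)%N ->
  floyd_metric (expR (- a)) (c 0%N) (c n) <=
  2 * expR (3 * a) / a * \sum_(i < n) visual_kernel a (c i) (c i.+1).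
Proof.
elim: n => // -[_ _|n IH _].
  by rewrite big_ord1; apply: floyd_metric_le_visual_kernel.
rewrite big_ord_recr /= mulrDr.
apply: le_trans (floyd_metric_triangle (c n.+1) _ _) _.
by apply: lerD; [exact: IH|exact: floyd_metric_le_visual_kernel].
Qed.

Lemma floyd_metric_le_visual_metric xi eta :
  floyd_metric (expR (- a)) xi eta <=
  2 * expR (3 * a) / a * visual_metric a xi eta.
Proof.
have C0 : 0 < 2 * expR (3 * a) / a by rewrite !mulr_gt0 ?invr_gt0 ?expR_gt0.
rewrite -ler_pdivrMl//; apply: lb_le_inf.
  exists (visual_kernel a xi eta).
  by exists 1%N, (fun n => if n is 0%N then xi else eta); rewrite big_ord1.
move=> _ [n [c [n0 <- <- ->]]].
by rewrite ler_pdivrMl//; apply: floyd_metric_le_chain.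
Qed.

Hypothesis a_small : expR (2 * (a * delta)) <= 2.

(** Along sequences converging to the two boundary points, the error term of
    [kernel_le_floyd] tends to 0, since d(o, y j) = (y j|y j) tends to +oo. *)
Lemma visual_kernel_le_floyd_metric xi eta :
  visual_kernel a xi eta <= 2 * expR (3 * a) * floyd_metric (expR (- a)) xi eta.
Proof.
have [x cx] := boundary_seq xi; have [y cy] := boundary_seq eta.
set C := 2 * expR (3 * a); set D := 2 * expR a.
have C0 : 0 < C by rewrite mulr_gt0 ?expR_gt0.
have D0 : 0 < D by rewrite mulr_gt0 ?expR_gt0.
apply/ler_addgt0Pr => eps eps0; have e2 : 0 < eps / 2 by lra.
have v0 : 0 < C * floyd_metric (expR (- a)) xi eta + eps.
  by rewrite ltr_wpDl// mulr_ge0 ?floyd_metric_ge0// ltW.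
have [s es] := expR_surj v0.
have [M Mrho] := floyd_metric_pair_cvg cx cy (divr_gt0 e2 C0).
have [N Ny] := gromov_equiv_kernel (converges_equiv Xhyp cy cy) (divr_gt0 e2 D0).
rewrite es; apply: visual_kernel_le.
apply: (@boundary_prod_ge _ _ _ _ _ x y s (maxn M N)) => // i j.
rewrite !geq_max => /andP[Mi _] /andP[Mj Nj].
have : K (x i) (y j) <= expR (- (a * s)).
  rewrite -es; apply: le_trans (kernel_le_floyd _ a_gt0 Xconn Xhyp a_small _ _) _.
  rewrite -/C -/D.
  have : C * rho (x i) (y j) <=
      C * (floyd_metric (expR (- a)) xi eta + eps / 2 / C).
    rewrite ler_pM2l//; have := Mrho i j Mi Mj; rewrite ler_norml => /andP[]; lra.
  have : D * expR (- (a * dist o (y j))) <= D * (eps / 2 / D).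
    by rewrite ler_pM2l//; have := Ny j j Nj Nj; rewrite /gromov_kernel gromov_prodxx.
  rewrite mulrDr ![_ * (_ / _)]mulrC !divfK ?gt_eqF//; lra.
by rewrite /gromov_kernel ler_expR lerN2 ler_pM2l.
Qed.

End FloydOnBoundary.

Lemma visual_metric_le_kernel (R : realType) (X : graph) (o : gpoint R X) (a : R)
    (xi eta : boundary o) :
  visual_metric a xi eta <= visual_kernel a xi eta.
Proof.
apply: ge_inf.
  by exists 0 => _ [n [c [_ _ _ ->]]]; apply: sumr_ge0 => i _; apply: visual_kernel_ge0.
exists 1%N, (fun n => if n is 0%N then xi else eta); split=> //.
by rewrite big_ord1.
Qed.

(** * Comparison of the visual and Floyd metrics *)

Theorem proposition6p1 (R : realType) (X : graph) (delta : R) (o : gpoint R X)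
    (Xconn : connected_graph R X) (Xhyp : hyperbolic X delta) :
  exists2 a0 : R, 0 < a0 &
    forall a : R, 0 < a <= a0 ->
      exists2 C : R, 1 <= C &
        forall xi eta : boundary o,
          C^-1 * floyd_metric (expR (- a)) xi eta <= visual_metric a xi eta
            <= C * floyd_metric (expR (- a)) xi eta.
Proof.
have L0 : 0 < ln 2 :> R by apply: ln_gt0; lra.
pose D := `|delta| + 1.
have D0 : 0 < D by rewrite ltr_wpDl.
(* D > 0 dominates delta, so that exp(2 a delta) <= 2 for all a <= ln 2 / (2 D) *)
exists (ln 2 / (2 * D)) => [|a /andP[a0 a_le]]; first by rewrite divr_gt0// mulr_gt0.
have a_small : expR (2 * (a * delta)) <= 2.
  rewrite -[leRHS]lnK ?posrE// ler_expR.
  move: a_le; rewrite ler_pdivlMr ?mulr_gt0// => a_le.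
  have : a * delta <= a * D.
    by rewrite ler_pM2l//; have := ler_norm delta; rewrite /D; lra.
  by lra.
set A := 2 * expR (3 * a) / a; set B := 2 * expR (3 * a).
have A0 : 0 < A by rewrite !mulr_gt0 ?invr_gt0 ?expR_gt0.
have B0 : 0 < B by rewrite !mulr_gt0 ?expR_gt0.
exists (1 + A + B) => [|xi eta]; first lra.
have F0 := floyd_metric_ge0 a0 Xconn Xhyp xi eta.
have C0 : 0 < 1 + A + B by lra.
apply/andP; split; last first.
  apply: le_trans (visual_metric_le_kernel _ _ _) _.
  apply: le_trans (visual_kernel_le_floyd_metric a0 Xconn Xhyp a_small _ _) _.
  by rewrite ler_wpM2r// -/B; lra.
have F_le := floyd_metric_le_visual_metric a0 Xconn Xhyp xi eta.
have V0 : 0 <= visual_metric a xi eta.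
  by rewrite -(pmulr_rge0 _ A0); apply: le_trans F0 F_le.
rewrite ler_pdivrMl//; apply: (le_trans F_le).
by rewrite -/A ler_wpM2r//; lra.
Qed.
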